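(* Let $p\in[1,\infty)$, $I=[0,1]$, $f\in L^p(I)$, $n\in\mathbb{N}$, and let $0=x_0<x_1<\dots<x_N=1$. Let $u_i(x)=a_ix+b_i$, $i\in\mathbb{N}_N$, be the affine maps with $u_i(0)=x_{i-1}$, $u_i(1)=x_i$. Let $\alpha_i\in L^\infty(I)$, $i\in\mathbb{N}_N$, satisfy $\Lambda:=\left(\sum_{i=1}^Na_i\|\alpha_i\|_\infty^p\right)^{1/p}<1$. Define $T:L^p(I)\to L^p(I)$ by \[ Tg=f+\sum_{i=1}^N(\alpha_i\circ u_i^{-1})\,\big((g-\widehat M_nf)\circ u_i^{-1}\big)\,\chi_{u_i(I)}. \] Then $T$ is a contraction on $L^p(I)$ with Lipschitz constant $\Lambda$; its unique fixed point $f^\alpha_n\in L^p(I)$ satisfies $f^\alpha_n=f+\sum_{i=1}^N(\alpha_i\circ u_i^{-1})((f^\alpha_n-\widehat M_nf)\circ u_i^{-1})\chi_{u_i(I)}$; and the map $L^p(I)\to L^p(I)$, $f\mapsto f^\alpha_n$, is a bounded linear operator.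
   Context: The integral MKZ operator is $\widehat M_nf(x)=\int_0^1H_n(x,s)f(s)\,ds$, where $H_n(x,s)=\sum_{k=0}^\infty\widehat m_{nk}(x)\chi_{I_k}(s)$, $\widehat m_{nk}(x)=(n+1)\binom{k+n+1}{k}x^k(1-x)^n$, $I_k=\left[\frac{k}{k+n},\frac{k+1}{k+n+1}\right]$, and $\chi_S$ is the indicator function of $S$. *)

(* Defs.v *)
From HB Require Import structures.
From mathcomp Require Import all_boot all_order all_algebra.
From mathcomp Require Import all_classical all_reals all_analysis.

Set Implicit Arguments.
Unset Strict Implicit.
Unset Printing Implicit Defensive.
Import Order.TTheory GRing.Theory Num.Theory.
Import numFieldNormedType.Exports.

Local Open Scope classical_set_scope.
Local Open Scope ring_scope.

Section Defs.
Variable R : realType.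

Lemma measurable_I : measurable (`[0, 1]%classic : set (measurableTypeR R)).
Proof. exact: measurable_itv. Qed.

Definition muI : {measure set (measurableTypeR R) -> \bar R} :=
  mrestr (@lebesgue_measure R) measurable_I.

Definition inL (p : \bar R) (g : R -> R) : Prop :=
  measurable_fun (`[0, 1]%classic : set R) g /\ finite_norm muI p g.

Definition normL (p : \bar R) (g : R -> R) : \bar R :=
  'N[muI]_p [EFin \o g].

Definition mhat (n k : nat) (x : R) : R :=
  (n.+1)%:R * ('C(k + n.+1, k))%:R * x ^+ k * (1 - x) ^+ n.

Definition Ik (n k : nat) : set R :=
  `[ (k%:R / (k + n)%:R), (k.+1%:R / (k + n).+1%:R) ]%classic.

Definition Hn (n : nat) (x s : R) : R :=
  \big[+%R/0%R]_(0 <= k <oo) (mhat n k x * \1_(Ik n k) s).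

(** the integral MKZ operator: \hat M_n f (x) = int_0^1 H_n(x,s) f(s) ds *)
Definition Mhat (n : nat) (f : R -> R) (x : R) : R :=
  Rintegral (@lebesgue_measure R) `[0, 1]%classic (fun s => Hn n x s * f s).

(** partition 0 = xs 0 < xs 1 < ... < xs N = 1; u_i(x) = a_i x + b_i with
    u_i(0) = xs (i-1), u_i(1) = xs i, so a_i = xs i - xs (i-1). *)
Definition a_ (xs : nat -> R) (i : nat) : R := xs i - xs i.-1.
Definition u_ (xs : nat -> R) (i : nat) (t : R) : R := a_ xs i * t + xs i.-1.
Definition uinv (xs : nat -> R) (i : nat) (x : R) : R := (x - xs i.-1) / a_ xs i.

Definition Top (n N : nat) (xs : nat -> R) (alpha : nat -> R -> R)
    (f g : R -> R) (x : R) : R :=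
  f x + \sum_(1 <= i < N.+1)
          alpha i (uinv xs i x) * (g (uinv xs i x) - Mhat n f (uinv xs i x))
          * \1_(`[xs i.-1, xs i]%classic) x.

Definition Lambda (p : R) (N : nat) (xs : nat -> R) (alpha : nat -> R -> R) : R :=
  (\sum_(1 <= i < N.+1) a_ xs i * (fine (normL +oo%E (alpha i))) `^ p) `^ p^-1.

End Defs.

(* Main.v *)
(** Write [T g = f + A (g - M f)], where [A] sums the scaled copies
    [(alpha_i g) o u_i^-1] and [M] is the integral MKZ operator.

    The copies live on essentially disjoint intervals, so the change of
    variables [x = u_i y] gives [||A g||_p^p = sum_i a_i ||alpha_i g||_p^p],
    hence [||A g||_p <= Lambda ||g||_p].

    [M] is bounded on [L^p] because its kernel has marginals at most 1: in [s],
    since [m_k(x) |I_k| = binom(k+n-1,k) x^k (1-x)^n] is a negative binomial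
    distribution; in [x], since [m_k] is a beta density. For [x] in [I] the sum
    of the [m_k(x)] is finite, so [M f x] is defined by an absolutely convergent
    integral and is linear in [f] at every point of [I].

    The fixed point comes from the contraction principle, where completeness of
    [L^p] is only needed for geometrically convergent sequences: these converge
    almost everywhere, and Fatou's lemma controls the distance to the limit. *)
Require Import Defs.
From HB Require Import structures.
From mathcomp Require Import all_boot all_order all_algebra.
From mathcomp Require Import all_classical all_reals all_analysis.
From mathcomp Require Import measurable_realfun ess_sup_inf ring lra.
Import Order.TTheory GRing.Theory Num.Theory.
Import numFieldNormedType.Exports.
Local Open Scope classical_set_scope.
Local Open Scope ring_scope.

(** * Completeness of Lp along geometric sequences *)

(** Differentiability yields continuity of [powR] in its base only at positive points. At the limit
    0 the estimate is made by hand, by taking [u n] below e^(1/p). *)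
Lemma cvg_powR (R : realType) (p : R) (u : R^nat) (a : R) : 0 < p ->
  (forall n, 0 <= u n) -> u @ \oo --> a -> u n `^ p @[n --> \oo] --> a `^ p.
Proof.
move=> p0 u0 ua.
have a0 : 0 <= a.
  by rewrite -(cvg_lim _ ua)//; apply: limr_ge; [apply/cvg_ex; exists a|exact: nearW].
move: a0; rewrite le_eqVlt => /predU1P[a0|a0].
  rewrite -a0 powR0 ?gt_eqF//; apply/cvgrPdist_lt => e e0.
  have e'0 : 0 < e `^ p^-1 by rewrite powR_gt0.
  move: ua => /cvgrPdist_lt/(_ _ e'0); apply: filterS => n.
  rewrite -a0 !sub0r !normrN (ger0_norm (u0 n)) ger0_norm ?powR_ge0// => une.
  rewrite -[ltRHS]powRr1 ?(ltW e0)// -(mulVf (lt0r_neq0 p0)) powRrM.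
  by rewrite gt0_ltr_powR ?nnegrE ?powR_ge0.
apply: (@continuous_cvg _ _ _ _ _ u (fun y => y `^ p)) => //.
apply: differentiable_continuous; apply/derivable1_diffP.
by apply: derivable_powR; rewrite in_itv/= a0.
Qed.

Section Lnorm_complete.
Context d (T : measurableType d) (R : realType) (mu : {measure set T -> \bar R}).
Variables (p : R) (p1 : 1 <= p).
Implicit Types (g h : T -> R).

Let p0 : 0 < p. Proof. exact: lt_le_trans p1. Qed.
Let pn0 : p != 0. Proof. by rewrite gt_eqF. Qed.

Lemma LnormE g :
  ('N[mu]_p%:E[EFin \o g] = (\int[mu]_x (`|g x| `^ p)%:E) `^ p^-1)%E.
Proof. by rewrite unlock. Qed.

(** Moves norm bounds to integrals of p-th powers, where monotone convergence and Fatou's lemma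
    apply. *)
Lemma le_LnormP g (e : R) : 0 <= e ->
  ('N[mu]_p%:E[EFin \o g] <= e%:E)%E <->
  (\int[mu]_x (`|g x| `^ p)%:E <= (e `^ p)%:E)%E.
Proof.
move=> e0; have i0 : (0 <= \int[mu]_x (`|g x| `^ p)%:E)%E.
  by apply: integral_ge0 => x _; rewrite lee_fin powR_ge0.
rewrite -poweR_EFin; split => [h|h].
- rewrite -[leLHS]poweRe1 ?i0// -(mulVf pn0) poweRrM -LnormE.
  by apply: gt0_ler_poweR => //; rewrite ?in_itv/= ?lee_fin ?e0 ?leey ?Lnorm_ge0// ltW.
- rewrite -[leRHS]poweRe1 ?lee_fin// -(mulfV pn0) poweRrM LnormE.
  apply: gt0_ler_poweR => //; rewrite ?in_itv/= ?poweR_ge0 ?lee_fin ?powR_ge0 ?leey ?i0//.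
  by rewrite invr_ge0 ltW.
Qed.

Lemma measurable_norm_powR (D : set T) g : measurable_fun D g ->
  measurable_fun D (fun x => `|g x| `^ p).
Proof.
move=> mg; apply: (measurableT_comp (measurable_powR p)).
exact: measurableT_comp.
Qed.

Section fast_cauchy.
Variables (g : nat -> T -> R) (c k : R).
Hypotheses (k01 : 0 <= k < 1) (c0 : 0 <= c).
Hypothesis mg : forall n, measurable_fun setT (g n).
Hypothesis gE : forall n,
  ('N[mu]_p%:E[EFin \o (g n.+1 \- g n)%R] <= (c * k ^+ n)%:E)%E.

(** The sum of c k^j over j >= n, which bounds the distance from [g n] to every later term. *)
Let e n := c * k ^+ n / (1 - k).

Let k1 : 0 < 1 - k. Proof. by rewrite subr_gt0; case/andP: k01. Qed.
Let k0 : 0 <= k. Proof. by case/andP: k01. Qed.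

Let eS n : e n = e n.+1 + c * k ^+ n.
Proof. by rewrite /e exprS; field; rewrite gt_eqF. Qed.

Let e_ge0 n : 0 <= e n.
Proof. by rewrite /e divr_ge0 ?mulr_ge0 ?exprn_ge0 ?(ltW k1). Qed.

Let tail n m : ('N[mu]_p%:E[EFin \o (g (m + n)%N \- g n)%R] <= (e n)%:E)%E.
Proof.
elim: m n => [|m IH] n.
  rewrite add0n (_ : (g n \- g n)%R = cst 0); last first.
    by apply/funext => x /=; rewrite subrr.
  by rewrite (_ : EFin \o _ = cst 0%E)// Lnorm0 ?lee_fin// eqe.
rewrite addSnnS (_ : (_ \- _)%R = (g (m + n.+1)%N \- g n.+1) \+ (g n.+1 \- g n)); last first.
  by apply/funext => x /=; rewrite addrA subrK.
apply: le_trans (minkowski_EFin _ _ _ _) _ => //; [exact: measurable_funB..|].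
by rewrite eS EFinD leeD.
Qed.

Let G J x := \sum_(j < J) `|g j.+1 x - g j x|.

Let mG J : measurable_fun setT (G J).
Proof.
apply: measurable_sum => j; apply: measurableT_comp => //.
exact: measurable_funB.
Qed.

(** [e 0 - e J] is the sum of c k^j over j < J, so the bounds on the increments add up exactly. *)
Let NG J : ('N[mu]_p%:E[EFin \o G J] <= (e 0 - e J)%:E)%E.
Proof.
elim: J => [|J IH].
  rewrite subrr (_ : EFin \o _ = cst 0%E) ?Lnorm0 ?eqe//.
  by apply/funext => x /=; rewrite /G big_ord0.
rewrite (_ : G J.+1 = G J \+ (Num.norm \o (g J.+1 \- g J))); last first.
  by apply/funext => x /=; rewrite /G big_ord_recr.
apply: le_trans (minkowski_EFin _ _ _ _) _ => //.
  by apply: measurableT_comp => //; exact: measurable_funB.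
rewrite (_ : e 0 - e J.+1 = (e 0 - e J) + c * k ^+ J); last first.
  by rewrite [e J]eS; ring.
rewrite EFinD leeD// (_ : EFin \o _ = abse \o (EFin \o (g J.+1 \- g J))%R)//.
by rewrite Lnorm_abse.
Qed.

(** Monotone convergence bounds the integral of [F], the limit of |G J|^p, by (e 0)^p. Hence [F] is
    finite almost everywhere, and there F^(1/p) bounds every [G J]. *)
Let ae_bnd : {ae mu, forall x, exists M, forall J, G J x <= M}.
Proof.
pose F x := limn (fun J => (`|G J x| `^ p)%:E).
have mGp J : measurable_fun setT (fun x => (`|G J x| `^ p)%:E).
  by apply/measurable_EFinP; exact: measurable_norm_powR.
have Gp0 J x : (0 <= (`|G J x| `^ p)%:E)%E by rewrite lee_fin powR_ge0.
have GS x : {homo G^~ x : n m / (n <= m)%N >-> n <= m}.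
  by apply/nondecreasing_seqP => J; rewrite /G big_ord_recr/= lerDl.
have G0 J x : 0 <= G J x by apply: sumr_ge0.
have GpS x : {homo (fun J => (`|G J x| `^ p)%:E) : n m / (n <= m)%N >-> (n <= m)%E}.
  move=> n m nm; rewrite lee_fin ge0_ler_powR ?nnegrE// ?(ltW p0)//.
  by rewrite !ger0_norm// GS.
have cF x : (fun J => (`|G J x| `^ p)%:E) J @[J --> \oo] --> F x.
  exact: (ereal_nondecreasing_is_cvgn (GpS x)).
have GpF J x : ((`|G J x| `^ p)%:E <= F x)%E.
  rewrite /F (cvg_lim _ (ereal_nondecreasing_cvgn (GpS x)))//.
  by apply: ereal_sup_ubound; exists J.
have F0 x : (0 <= F x)%E by exact: le_trans (Gp0 0 x) (GpF 0 x).
have mF : measurable_fun setT F.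
  by apply: (emeasurable_fun_cvg (fun J x => (`|G J x| `^ p)%:E)) => // x _; exact: cF.
have iF : (\int[mu]_x F x <= (e 0 `^ p)%:E)%E.
  rewrite monotone_convergence//.
  apply: lime_le.
    apply: ereal_nondecreasing_is_cvgn => m n mn.
    by apply: ge0_le_integral => // x _; exact: GpS.
  apply: nearW => J; apply/le_LnormP => //.
  by apply: le_trans (NG J) _; rewrite lee_fin gerBl.
have FI : mu.-integrable setT F.
  apply/integrableP; split => //; apply: le_lt_trans (ltry (e 0 `^ p)).
  by under eq_integral do rewrite gee0_abs//.
have := integrable_ae measurableT FI.
apply: filterS => x /(_ I) Ffin.
exists (fine (F x) `^ p^-1) => J.
have : (`|G J x| `^ p <= fine (F x)).
  by rewrite -lee_fin fineK.
rewrite ger0_norm// => GM.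
rewrite -[leLHS]powRr1// -(mulfV pn0) powRrM ge0_ler_powR ?nnegrE ?powR_ge0//.
  by rewrite invr_ge0 ltW.
by rewrite fine_ge0.
Qed.

(** Where [G] is bounded, the telescoping series of [g] converges absolutely. *)
Let ae_cvg : {ae mu, forall x, cvgn (g ^~ x)}.
Proof.
apply: filterS ae_bnd => x [M GM].
have : cvgn (series (telescope (g ^~ x))).
  apply: normed_cvg; apply: nondecreasing_is_cvgn.
    by apply/nondecreasing_seqP => n; rewrite [leRHS]seriesSr lerDl normr_ge0.
  by exists M => _ [J _ <-]; rewrite /normed_series_of seriesEord; exact: GM.
rewrite telescopeK => cu.
rewrite (_ : g ^~ x = (fun n => g n x - g 0 x) \+ cst (g 0 x)); last first.
  by apply/funext => n /=; rewrite subrK.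
by apply: is_cvgD => //; exact: is_cvg_cst.
Qed.

Lemma Lnorm_fast_cauchy : exists2 h : T -> R, measurable_fun setT h &
  forall n, ('N[mu]_p%:E[EFin \o (h \- g n)%R] <= (c * k ^+ n / (1 - k))%:E)%E.
Proof.
(* Taking a limsup in the extended reals keeps [h] measurable everywhere, including where [g] fails
   to converge. *)
pose h x := fine (limn_esup (fun J => (g J x)%:E)).
have mh : measurable_fun setT h.
  apply: (measurableT_comp (fine_measurable _)) => //.
  by apply: measurable_fun_limn_esup => n; exact/measurable_EFinP.
exists h => // n; apply/le_LnormP; first exact: e_ge0.
have md m : measurable_fun setT (fun x => (`|g (m + n)%N x - g n x| `^ p)%:E).
  by apply/measurable_EFinP; apply: measurable_norm_powR; exact: measurable_funB.
(* Almost everywhere |h - g n|^p is the liminf of |g (m + n) - g n|^p, to which Fatou's lemma and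
   [tail] apply. *)
rewrite (_ : (\int[mu]_x _)%E =
    (\int[mu]_x limn_einf (fun m => (`|g (m + n)%N x - g n x| `^ p)%:E))%E).
  apply: le_trans (fatou _ _ _ _) _ => //.
  apply: le_trans (limn_einf_sup _) _.
  rewrite -[leRHS]/(((e n) `^ p)%:E) limn_esup_lim.
  apply: lime_le; first exact: is_cvg_esups.
  apply: nearW => m; apply: ge_ereal_sup => _ [i /= _ <-].
  by apply/le_LnormP; [exact: e_ge0|exact: tail].
apply: ge0_ae_eq_integral => //.
- by apply/measurable_EFinP; apply: measurable_norm_powR; exact: measurable_funB.
- apply: (emeasurable_fun_cvg _ _ (measurable_fun_einfs md)) => x _.
  by rewrite limn_einf_lim; exact: is_cvg_einfs.
- move=> x _; rewrite limn_einf_lim; apply: lime_ge; first exact: is_cvg_einfs.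
  by apply: nearW => m; apply: le_ereal_inf_tmp => _ [i /= _ <-]; rewrite lee_fin powR_ge0.
apply: filterS ae_cvg => x gx _.
have gh : g J x @[J --> \oo] --> h x.
  rewrite /h; suff -> : limn_esup (fun J => (g J x)%:E) = (limn (g ^~ x))%:E by exact: gx.
  have : (g J x)%:E @[J --> \oo] --> (limn (g ^~ x))%:E.
    by apply: cvg_EFin; [exact: nearW|exact: gx].
  by move=> /cvg_limn_einf_sup[].
suff : (`|g (m + n)%N x - g n x| `^ p)%:E @[m --> \oo] -->
    (`|h x - g n x| `^ p)%:E by move=> /cvg_limn_einf_sup[-> _].
apply: cvg_EFin; first exact: nearW.
apply: (@cvg_powR _ _ (fun m => `|g (m + n)%N x - g n x|)) => //.
apply: cvg_norm; apply: cvgB; last exact: cvg_cst.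
by rewrite (cvg_shiftn n (g ^~ x)).
Qed.

End fast_cauchy.

Lemma LnormB_sym g h : ('N[mu]_p%:E[EFin \o (g \- h)%R] =
  'N[mu]_p%:E[EFin \o (h \- g)%R])%E.
Proof.
rewrite !LnormE; congr (_ `^ _)%E; apply: eq_integral => x _ /=.
by rewrite distrC.
Qed.

Lemma Lnorm_cst0 : ('N[mu]_p%:E[EFin \o cst 0%R] = 0)%E.
Proof. by rewrite (_ : EFin \o _ = cst 0%E)// Lnorm0 ?eqe. Qed.

(** Picard iteration from 0, with c the norm of S 0. On functions the norm is only a seminorm, so
    the fixed point equation comes out almost everywhere. *)
Lemma Lnorm_contraction_fixpoint (S : (T -> R) -> T -> R) (k : R) : 0 <= k < 1 ->
  (forall g, measurable_fun setT g -> finite_norm mu p%:E g ->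
    measurable_fun setT (S g) /\ finite_norm mu p%:E (S g)) ->
  (forall g h, measurable_fun setT g -> finite_norm mu p%:E g ->
    measurable_fun setT h -> finite_norm mu p%:E h ->
    ('N[mu]_p%:E[EFin \o (S g \- S h)%R] <= k%:E * 'N[mu]_p%:E[EFin \o (g \- h)%R])%E) ->
  exists g, [/\ measurable_fun setT g, finite_norm mu p%:E g & g = S g %[ae mu]].
Proof.
move=> k01 SL Sk; have /andP[k0 k1] := k01.
pose g := fix g n := if n is m.+1 then S (g m) else cst 0.
have gL n : measurable_fun setT (g n) /\ finite_norm mu p%:E (g n).
  elim: n => [|n [? ?]]; last exact: SL.
  by split=> //; rewrite /finite_norm Lnorm_cst0.
pose c := fine 'N[mu]_p%:E[EFin \o (g 1%N \- g 0%N)%R].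
have g10 : (g 1%N \- g 0%N)%R = g 1%N by apply/funext => x /=; rewrite subr0.
have c0 : 0 <= c by rewrite fine_ge0// Lnorm_ge0.
have gE n : ('N[mu]_p%:E[EFin \o (g n.+1 \- g n)%R] <= (c * k ^+ n)%:E)%E.
  elim: n => [|n IH].
    rewrite expr0 mulr1 /c fineK// ge0_fin_numE ?Lnorm_ge0// g10.
    by case: (gL 1%N).
  have [[? ?] [? ?]] := (gL n, gL n.+1).
  apply: le_trans (Sk _ _ _ _ _ _) _ => //.
  by rewrite exprS mulrCA EFinM lee_wpmul2l// lee_fin.
have [h mh hg] := Lnorm_fast_cauchy _ _ _ k01 c0 (fun n => (gL n).1) gE.
have hL : finite_norm mu p%:E h.
  have -> : h = (h \- g 0%N)%R by apply/funext => x /=; rewrite subr0.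
  exact: le_lt_trans (hg 0%N) (ltry _).
have [mSh ShL] := SL _ mh hL.
exists h; split => //.
(* Since [g n.+1] is [S (g n)], h - S h splits into two terms, each of norm at most c k^n / (1 - k),
   which tends to 0. *)
have hSh n : ('N[mu]_p%:E[EFin \o (h \- S h)%R] <= (c * k ^+ n / (1 - k) * 2)%:E)%E.
  have [[? ?] [? ?]] := (gL n, gL n.+1).
  rewrite (_ : (_ \- _)%R = (h \- g n.+1) \+ (S (g n) \- S h)); last first.
    by apply/funext => x /=; rewrite addrA subrK.
  apply: le_trans (minkowski_EFin _ _ _ _) _ => //; [exact: measurable_funB..|].
  rewrite mulr_natr mulr2n EFinD; apply: leeD.
    apply: le_trans (hg n.+1) _; rewrite lee_fin ler_wpM2r ?invr_ge0 ?subr_ge0 ?(ltW k1)//.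
    by rewrite ler_wpM2l// exprS ler_piMl ?exprn_ge0// ltW.
  apply: le_trans (Sk _ _ _ _ _ _) _ => //.
  rewrite LnormB_sym; apply: le_trans (hg n); rewrite gee_pMl ?Lnorm_ge0 ?lee_fin ?(ltW k1)//.
have : ('N[mu]_p%:E[EFin \o (h \- S h)%R] <= 0)%E.
  have cv : (c * k ^+ n / (1 - k) * 2)%:E @[n --> \oo] --> 0%E.
    apply: cvg_EFin; first exact: nearW.
    rewrite (_ : fine \o _ = geometric (c / (1 - k) * 2) k).
      by apply: cvg_geometric; rewrite ger0_norm.
    by apply/funext => n /=; rewrite [RHS]mulrAC (mulrAC c).
  rewrite -(cvg_lim _ cv)//; apply: lime_ge; first by apply/cvg_ex; exists 0%E.
  exact: nearW.
rewrite le_eqVlt ltNge Lnorm_ge0 orbF => /eqP N0.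
have : EFin \o (h \- S h)%R = \0%E %[ae mu].
  apply: Lnorm_eq0_eq0 N0; last by rewrite lte_fin.
  by apply/measurable_EFinP; exact: measurable_funB.
by apply: filterS => x /(_ I) [/eqP]; rewrite subr_eq0 => /eqP.
Qed.

End Lnorm_complete.

(** * Restriction and affine change of variables *)

Section ge0_integral_mrestr.
Local Open Scope ereal_scope.
Context d (T : measurableType d) (R : realType).
Import HBNNSimple.

(* Elements of [L^p(I)] are only measurable on [I], so it is the simple
   functions below [f], not [f] itself, that are cut off outside [D]. *)
Lemma ge0_integral_conull (mu : {measure set T -> \bar R}) (D : set T)
    (f : T -> \bar R) : measurable D -> mu (~` D) = 0 -> (forall x, 0 <= f x) ->
  \int[mu]_x f x = \int[mu]_(x in D) f x.
Proof.
move=> mD D0 f0; rewrite ge0_integralTE// ge0_integralE//.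
apply/eqP; rewrite eq_le; apply/andP; split; apply: ge_ereal_sup => _ [h /= hf <-].
- apply: ereal_sup_ubound; exists (proj_nnsfun h mD).
    move=> x; rewrite -mrestrict !patchE; case: ifPn => // _; exact: hf.
  rewrite -mrestrict -integral_nnsfun//.
  have -> : sintegral mu h = \int[mu]_x (h x)%:E.
    by rewrite integral_nnsfun// patch_setT.
  rewrite (@ge0_negligible_integral _ _ _ _ setT (~` D))//.
  + by rewrite setTD setCK.
  + exact: measurableC.
  + by apply/measurable_EFinP.
  + by move=> x _; rewrite lee_fin.
- apply: ereal_sup_ubound; exists h => //= x.
  by apply: le_trans (hf x) _; rewrite patchE; case: ifPn.
Qed.

(** The complement of [D] is null for the restricted measure, which agrees with [mu] on subsets of
    [D]. *)
Lemma ge0_integral_mrestr (mu : {measure set T -> \bar R}) (D : set T)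
    (mD : measurable D) (f : T -> \bar R) : (forall x, 0 <= f x) ->
  \int[mrestr mu mD]_x f x = \int[mu]_(x in D) f x.
Proof.
move=> f0; rewrite (@ge0_integral_conull _ D)//; last first.
  by rewrite -[LHS]/(mu (~` D `&` D)) setICl measure0.
apply: eq_measure_integral => A mA AD.
by rewrite -[LHS]/(mu (A `&` D)) setIidl.
Qed.

End ge0_integral_mrestr.

Section affine_change_of_variable.
Context (R : realType).
Notation mu := (@lebesgue_measure R).
Variables (a b : R) (a0 : 0 < a).

Let phi (x : measurableTypeR R) : measurableTypeR R := (x - b) / a.

Let mphi : measurable_fun setT phi.
Proof. by apply: measurable_funM => //; exact: measurable_funB. Qed.

(** The image measure divided by a gives ]c, e] the mass e - c, because the preimage is ]ca + b, ea
    + b]. Uniqueness of Lebesgue measure then applies. *)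
Let push_lebesgue (A : set (measurableTypeR R)) : measurable A ->
  pushforward mu phi A = (a%:E * mu A)%E.
Proof.
have a'0 : 0 <= a^-1 by rewrite invr_ge0 ltW.
have am0 : 0 <= a by exact: ltW.
have [nu nuE] : exists nu : {measure set (measurableTypeR R) -> \bar R},
    forall B, nu B = (a^-1%:E * mu (phi @^-1` B))%E.
  unshelve eexists; first refine (mscale (NngNum a'0) (pushforward mu phi)).
    exact: mphi.
  by [].
suff E B : measurable B -> mu B = nu B.
  by move=> mA; rewrite E// nuE muleA -EFinM mulfV ?gt_eqF// mul1e.
move=> mB; apply: lebesgue_measure_unique => // _ [[c e] _ <-].
rewrite nuE (_ : phi @^-1` _ = `]c * a + b, e * a + b]%classic); last first.
  apply/seteqP; split => x /=; rewrite /phi !in_itv/=;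
    by rewrite ltr_pdivlMr// ler_pdivrMr// ltrBrDr lerBlDr.
rewrite !lebesgue_measure_itv/= !lte_fin ltrD2r ltr_pM2r//.
case: ifPn => // _; last by rewrite mule0.
by rewrite -!EFinB -EFinM; congr EFin; field; rewrite gt_eqF.
Qed.

Lemma ge0_integral_affine (D : set (measurableTypeR R)) (f : R -> \bar R) :
  measurable D -> measurable_fun D f -> (forall x, D x -> 0 <= f x)%E ->
  (\int[mu]_(x in [set x | D ((x - b) / a)%R]) f ((x - b) / a)%R =
   a%:E * \int[mu]_(x in D) f x)%E.
Proof.
move=> mD mf f0.
have am0 : 0 <= a by exact: ltW.
rewrite -[LHS](@ge0_integral_pushforward _ _ _ _ _ _ mphi)//; last first.
  by move=> x /[!inE]; exact: f0.
rewrite -[a]/(NngNum am0)%:num -ge0_integral_mscale//.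
by apply: eq_measure_integral => A mA _; exact: push_lebesgue.
Qed.

End affine_change_of_variable.

(** * The L^p seminorm on the unit interval *)

Section normL_theory.
Context (R : realType).
Notation mu := (@lebesgue_measure R).
Notation I := (`[0%R, 1%R]%classic : set (measurableTypeR R)).
Variables (p : R) (p1 : 1 <= p).
Implicit Types (g h : R -> R).

Let p0 : 0 < p. Proof. exact: lt_le_trans p1. Qed.
Let pn0 : p != 0. Proof. by rewrite gt_eqF. Qed.

Lemma measurable_itv01 : measurable (`[0%R, 1%R]%classic : set (measurableTypeR R)).
Proof. exact: measurable_itv. Qed.

Lemma ae_muI : {ae (muI R), forall x, I x}.
Proof.
exists (~` I); split => //; first by apply: measurableC; exact: measurable_itv.
by rewrite -[LHS]/(mu (~` I `&` I)) setICl measure0.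
Qed.

Lemma ae_muI_lebesgue (P : R -> Prop) : {ae (muI R), forall x, P x} ->
  {ae mu, forall x, I x -> P x}.
Proof.
move=> [A [mA A0 PA]]; exists (A `&` I); split => //.
- by apply: measurableI => //; exact: measurable_itv.
- by move=> x /=; rewrite not_implyE => -[Ix Px]; split => //; exact: PA.
Qed.

Lemma normLE g : (normL p%:E g =
  (\int[mu]_(x in I) (`|g x| `^ p)%:E) `^ p^-1)%E.
Proof.
by rewrite /normL LnormE ge0_integral_mrestr.
Qed.

Lemma normL_ge0 g : (0 <= normL p%:E g)%E.
Proof. exact: Lnorm_ge0. Qed.

Lemma powR_normL g : (normL p%:E g `^ p = \int[mu]_(x in I) (`|g x| `^ p)%:E)%E.
Proof.
rewrite normLE -poweRrM mulVf// poweRe1//.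
by apply: integral_ge0 => x _; rewrite lee_fin powR_ge0.
Qed.

Lemma eq_normL g h : {in I, g =1 h} -> normL p%:E g = normL p%:E h.
Proof.
move=> gh; rewrite !normLE; congr (_ `^ _)%E; apply: eq_integral => x xI.
by rewrite gh.
Qed.

Lemma ae_eq_normL g h : measurable_fun I g -> measurable_fun I h ->
  g = h %[ae (muI R)] -> normL p%:E g = normL p%:E h.
Proof.
move=> mg mh /ae_muI_lebesgue gh; rewrite !normLE; congr (_ `^ _)%E.
apply: ge0_ae_eq_integral => //; try by apply/measurable_EFinP; exact: measurable_norm_powR.
by apply: filterS gh => x + Ix => /(_ Ix Logic.I) ->.
Qed.

(** Extension by zero makes a function that is measurable on [I] measurable everywhere; Minkowski's
    inequality and the contraction principle are transferred through it. *)
Lemma normL_patch g : normL p%:E (g \_ I) = normL p%:E g.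
Proof. by apply: eq_normL => x xI; rewrite patchE xI. Qed.

Lemma measurable_patchI g : measurable_fun I g -> measurable_fun setT (g \_ I).
Proof.
by move=> mg; apply/(measurable_restrict _ measurable_itv01 measurableT); rewrite setTI.
Qed.

Lemma normLD g h : measurable_fun I g -> measurable_fun I h ->
  (normL p%:E (g \+ h)%R <= normL p%:E g + normL p%:E h)%E.
Proof.
move=> mg mh; rewrite -(normL_patch g) -(normL_patch h).
rewrite -[leLHS](normL_patch (g \+ h)) (_ : _ \_ I = (g \_ I) \+ (h \_ I)).
  by apply: minkowski_EFin => //; exact: measurable_patchI.
by apply/funext => x /=; rewrite !patchE; case: ifPn => // _; rewrite addr0.
Qed.

Lemma normLN g : normL p%:E (\- g)%R = normL p%:E g.
Proof.
rewrite !normLE; congr (_ `^ _)%E; apply: eq_integral => x _ /=.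
by rewrite normrN.
Qed.

(** Takes p-th roots in the extended reals, so that operator bounds can be proved on integrals even
    when these are infinite. *)
Lemma le_normL (c : R) g h : 0 <= c ->
  (\int[mu]_(x in I) (`|g x| `^ p)%:E <=
   (c `^ p)%:E * \int[mu]_(x in I) (`|h x| `^ p)%:E)%E ->
  (normL p%:E g <= c%:E * normL p%:E h)%E.
Proof.
move=> c0; rewrite -!powR_normL -poweR_EFin -poweRM ?lee_fin ?normL_ge0// => le.
have ch0 : (0 <= c%:E * normL p%:E h)%E by rewrite mule_ge0 ?lee_fin ?normL_ge0.
rewrite -[leLHS](poweRe1 (normL_ge0 g)) -[leRHS](poweRe1 ch0).
rewrite -(mulfV pn0) !poweRrM gt0_ler_poweR ?invr_ge0 ?(ltW p0)//.
all: by rewrite in_itv/= ?poweR_ge0 ?leey.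
Qed.

Lemma normL_eq0 g : measurable_fun I g -> normL p%:E g = 0%E ->
  g = cst 0 %[ae (muI R)].
Proof.
move=> mg; rewrite -normL_patch => g0.
have := Lnorm_eq0_eq0 _ _ g0; rewrite lte_fin => /(_ _ p0)H.
have : EFin \o (g \_ I) = \0%E %[ae (muI R)].
  by apply: H; apply/measurable_EFinP; exact: measurable_patchI.
move=> gI0; have := ae_muI; apply: filterS2 gI0 => x /(_ Logic.I)/= + Ix _.
by rewrite patchE mem_set// => -[].
Qed.

Lemma inLP g : inL p%:E g <->
  measurable_fun I g /\ (\int[mu]_(x in I) (`|g x| `^ p)%:E < +oo)%E.
Proof.
rewrite /inL /finite_norm -/(normL _ _) normLE; split => -[mg gy]; split => //.
  have := poweR_lty p gy; rewrite -poweRrM mulVf// poweRe1//.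
  by apply: integral_ge0 => x _; rewrite lee_fin powR_ge0.
exact: poweR_lty.
Qed.

Lemma inL_finite g : inL p%:E g -> normL p%:E g \is a fin_num.
Proof. by move=> [_ gy]; rewrite ge0_fin_numE// normL_ge0. Qed.

Lemma inLD g h : inL p%:E g -> inL p%:E h -> inL p%:E (g \+ h)%R.
Proof.
move=> [mg gy] [mh hy]; split; first exact: measurable_funD.
by apply: le_lt_trans (normLD _ _ mg mh) _; rewrite lte_add_pinfty.
Qed.

Lemma inLN g : inL p%:E g -> inL p%:E (\- g)%R.
Proof.
by move=> [mg gy]; split; [exact: measurableT_comp|rewrite /finite_norm -/(normL _ _) normLN].
Qed.

Lemma inLB g h : inL p%:E g -> inL p%:E h -> inL p%:E (g \- h)%R.
Proof. by move=> gL hL; exact: (inLD g _ gL (inLN _ hL)). Qed.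

End normL_theory.

(** * Scaled copies on a partition *)

Section interval_partition.
Context (R : realType).
Notation mu := (@lebesgue_measure R).

(** Neighbouring intervals share an endpoint: the last one is first taken half-open to make the
    union disjoint, and the missing point has measure zero. *)
Lemma ge0_integral_partition (ys : nat -> R) m (F : R -> \bar R) :
  (forall i, (i < m)%N -> ys i <= ys i.+1) ->
  measurable_fun (`[ys 0%N, ys m]%classic : set R) F ->
  (forall x, `[ys 0%N, ys m]%classic x -> 0 <= F x)%E ->
  (\int[mu]_(x in `[ys 0%N, ys m]) F x =
   \sum_(0 <= i < m) \int[mu]_(x in `[ys i, ys i.+1]) F x)%E.
Proof.
elim: m => [|m IH] ysS mF F0; first by rewrite big_geq// set_itv1 integral_set1.
have ys_le i : (i <= m)%N -> ys 0%N <= ys i.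
  elim: i => // i IHi im; apply: le_trans (IHi (ltnW im)) (ysS _ _).
  exact: leq_trans im (leqnSn m).
have ymS := ysS m (leqnn _).
have E : `[ys 0%N, ys m.+1]%classic = `[ys 0%N, ys m]%classic `|` `]ys m, ys m.+1]%classic.
  by rewrite -itv_bndbnd_setU// bnd_simp ?ys_le.
have sub0 : `[ys 0%N, ys m]%classic `<=` `[ys 0%N, ys m.+1]%classic.
  by rewrite E; exact: subsetUl.
have sub1 : `]ys m, ys m.+1]%classic `<=` `[ys 0%N, ys m.+1]%classic.
  by rewrite E; exact: subsetUr.
rewrite big_nat_recr//.
rewrite -IH; last 3 first.
- by move=> i im; apply: ysS; exact: ltnW.
- by apply: measurable_funS mF.
- by move=> x /sub0; exact: F0.
rewrite [in LHS]E ge0_integral_setU//.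
- rewrite integral_itv_obnd_cbnd//.
  by apply: measurable_funS mF.
- by rewrite -E.
- by rewrite -E.
- apply/disj_setPS => x /= [] ; rewrite !in_itv/= => /andP[_ xm] /andP[+ _].
  by rewrite ltNge xm.
Qed.

End interval_partition.

Section read_bajraktarevic.
Context (R : realType).
Notation mu := (@lebesgue_measure R).
Notation I := (`[0%R, 1%R]%classic : set (measurableTypeR R)).
Variables (N : nat) (xs : nat -> R) (alpha : nat -> R -> R).
Hypotheses (xs0 : xs 0%N = 0) (xsN : xs N = 1).
Hypothesis xsS : forall i, (i < N)%N -> xs i < xs i.+1.
Hypothesis alphaL : forall i, (1 <= i <= N)%N -> inL +oo%E (alpha i).

(** The linear part of [Top]. At an interior partition point two closed intervals meet and both
    copies are added, which affects finitely many points only. *)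
Definition scaled_copies (g : R -> R) (x : R) : R :=
  \sum_(1 <= i < N.+1)
    alpha i (uinv xs i x) * g (uinv xs i x) * \1_(`[xs i.-1, xs i]%classic) x.

Let a_gt0 i : (1 <= i <= N)%N -> 0 < a_ xs i.
Proof. by case: i => // i /andP[_ iN]; rewrite subr_gt0 xsS. Qed.

Let xs_le i j : (i <= j <= N)%N -> xs i <= xs j.
Proof.
move=> /andP[]; elim: j => [|j IH]; first by rewrite leqn0 => /eqP->.
rewrite leq_eqVlt => /predU1P[->//|ij] jN.
by apply: le_trans (IH _ _) (ltW (xsS _ jN)) => //; exact: ltnW.
Qed.

Let xs01 i : (i <= N)%N -> 0 <= xs i <= 1.
Proof. by move=> iN; rewrite -xs0 -xsN !xs_le ?leqnn ?iN ?leq0n. Qed.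

Let uinvI i x : (1 <= i <= N)%N ->
  I (uinv xs i x) <-> `[xs i.-1, xs i]%classic x.
Proof.
move=> iN; have a0 := a_gt0 _ iN.
rewrite /uinv /= !in_itv/= ler_pdivlMr// ler_pdivrMr// mul0r mul1r /a_.
by rewrite subr_ge0 lerBlDr subrK.
Qed.

Let itv_sub i : (1 <= i <= N)%N -> `[xs i.-1, xs i]%classic `<=` I.
Proof.
case: i => // i /andP[_ iN] x /=; rewrite !in_itv/= => /andP[x1 x2].
have /andP[h1 _] := xs01 i (ltnW iN); have /andP[_ h2] := xs01 i.+1 iN.
by rewrite (le_trans h1 x1) (le_trans x2 h2).
Qed.

Let measurable_uinv i : measurable_fun setT (uinv xs i).
Proof. by apply: measurable_funM => //; exact: measurable_funB. Qed.

Let measurable_comp_uinv i (g : R -> R) : (1 <= i <= N)%N -> measurable_fun I g ->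
  measurable_fun (`[xs i.-1, xs i]%classic : set R) (g \o uinv xs i).
Proof.
move=> iN mg; apply: (measurable_comp (F := I)) => //.
- by move=> _ [x xi <-]; apply/uinvI.
- by apply: measurable_funTS; exact: measurable_uinv.
Qed.

(** [alpha i] and [g] are measurable on [I] only, so each copy is viewed as a function on its own
    subinterval extended by zero. *)
Lemma measurable_scaled_copies g : measurable_fun I g ->
  measurable_fun I (scaled_copies g).
Proof.
move=> mg; have -> : scaled_copies g = fun x => \sum_(i < N)
    alpha i.+1 (uinv xs i.+1 x) * g (uinv xs i.+1 x) * \1_(`[xs i, xs i.+1]%classic) x.
  by apply/funext => x; rewrite /scaled_copies big_add1 /= big_mkord.
apply: measurable_sum => i; have iN : (1 <= i.+1 <= N)%N by rewrite ltn_ord.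
rewrite (_ : (fun _ => _) = ((alpha i.+1 \o uinv xs i.+1) \*
    (g \o uinv xs i.+1)) \_ `[xs i, xs i.+1]%classic); last first.
  apply/funext => x /=; rewrite patchE indicE.
  by case: (x \in _); rewrite ?mulr1 ?mulr0.
apply/measurable_restrict; [exact: measurable_itv..|].
apply: (measurable_funS (E := `[xs i, xs i.+1]%classic)) => //.
by apply: measurable_funM; apply: (measurable_comp_uinv i.+1) => //; case: (alphaL _ iN).
Qed.

(** Every argument passed to [g] under a nonzero indicator lies in [I]. This lets identities for
    [Mhat] on [I] be used inside the copies at every [x]. *)
Lemma eq_scaled_copies g h x : {in I, g =1 h} ->
  scaled_copies g x = scaled_copies h x.
Proof.
move=> gh; rewrite /scaled_copies [LHS]big_nat_cond [RHS]big_nat_cond; apply: eq_bigr => i.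
rewrite andbT indicE => iN; case: (boolP (x \in _)) => xi; last by rewrite !mulr0.
by rewrite gh// inE; apply/uinvI => //; rewrite inE in xi.
Qed.

Lemma scaled_copies_linear (c1 c2 : R) g h x :
  scaled_copies (fun y => c1 * g y + c2 * h y) x =
  c1 * scaled_copies g x + c2 * scaled_copies h x.
Proof.
rewrite /scaled_copies !mulr_sumr -big_split/=.
by apply: eq_bigr => i _; ring.
Qed.

Lemma scaled_copiesE i g x : (1 <= i <= N)%N -> xs i.-1 < x < xs i ->
  scaled_copies g x = alpha i (uinv xs i x) * g (uinv xs i x).
Proof.
move=> iN /andP[x1 x2]; rewrite /scaled_copies.
rewrite (bigD1_seq i) ?iota_uniq//= ?mem_index_iota ?ltnS//.
rewrite indicE mem_set ?mulr1; last by rewrite /= in_itv/= !ltW.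
rewrite big_nat_cond big1 ?addr0// => j /andP[/andP[j1 jN] ji].
rewrite indicE memNset ?mulr0//= in_itv/= => /andP[y1 y2].
have := ji; rewrite neq_ltn => /orP[] ij.
- have := le_lt_trans (xs_le j i.-1 _) x1; rewrite ltNge y2 => /(_ _)/negP.
  apply => //; case: (i) iN ij => // i' /andP[_ iN] /=; rewrite ltnS => ->/=.
  exact: ltnW.
- have := lt_le_trans x2 (xs_le i j.-1 _); rewrite ltNge y1 => /(_ _)/negP.
  apply => //; case: (j) j1 jN ij => // j' _ jN /=; rewrite ltnS => ->/=.
  by rewrite -ltnS ltnW.
Qed.

Let integral_copy (G : R -> \bar R) i : (1 <= i <= N)%N ->
  measurable_fun I G -> (forall x, I x -> 0 <= G x)%E ->
  (\int[mu]_(x in `[xs i.-1, xs i]) G (uinv xs i x) =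
   (a_ xs i)%:E * \int[mu]_(x in I) G x)%E.
Proof.
move=> iN mG G0.
rewrite -(ge0_integral_affine R (a_ xs i) (xs i.-1) (a_gt0 _ iN) I)//.
congr (integral _ _ _); apply/seteqP; split => x /(uinvI _ _ iN) //.
Qed.

Let le_alpha i : (1 <= i <= N)%N ->
  {ae mu, forall x, I x -> `|alpha i x| <= fine (normL +oo%E (alpha i))}.
Proof.
move=> iN; have [_] := alphaL _ iN; rewrite /finite_norm -/(normL _ _) => afin.
(* The norm at exponent +oo is the essential supremum when the whole space has positive measure;
   this fact selects that case. *)
have muI1 : (0 < muI R setT)%E.
  by rewrite -[X in (_ < X)%E]/(mu (setT `&` I)) setTI lebesgue_measure_itv/= lte_fin ltr01 oppr0 adde0 lte_fin ltr01.
apply: ae_muI_lebesgue.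
have := ess_sup_ge (muI R) (abse \o (EFin \o alpha i)).
apply: filterS => x; rewrite -lee_fin => /le_trans; apply.
rewrite fineK; first by rewrite /normL unlock muI1.
by rewrite ge0_fin_numE// Lnorm_ge0.
Qed.

Lemma Lambda_ge0 (p : R) : 0 <= Lambda p N xs alpha.
Proof. exact: powR_ge0. Qed.

(** The p-th power of the norm is additive over the partition. The i-th piece contributes a_i times
    the integral of |alpha_i g|^p, where |alpha_i| is at most its essential bound almost
    everywhere. *)
Lemma normL_scaled_copies (p : R) g : 1 <= p -> measurable_fun I g ->
  (normL p%:E (scaled_copies g) <=
   (Lambda p N xs alpha)%:E * normL p%:E g)%E.
Proof.
move=> p1 mg; have p0 : 0 < p by exact: lt_le_trans p1.
have pn0 : p != 0 by rewrite gt_eqF.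
apply: le_normL => //; first exact: Lambda_ge0.
pose L i := fine (normL +oo%E (alpha i)).
have L0 i : 0 <= L i by rewrite fine_ge0// Lnorm_ge0.
rewrite /Lambda -powRrM mulVf// powRr1; last first.
  rewrite big_nat_cond; apply: sumr_ge0 => i /andP[/andP[i1 iN] _].
  by rewrite mulr_ge0 ?powR_ge0// ltW// a_gt0// i1.
have mF := measurable_scaled_copies _ mg.
have -> : (\int[mu]_(x in I) (`|scaled_copies g x| `^ p)%:E = \sum_(1 <= i < N.+1)
    \int[mu]_(x in `[xs i.-1, xs i]) (`|scaled_copies g x| `^ p)%:E)%E.
  rewrite big_add1/= -(ge0_integral_partition R xs N (fun x => (`|scaled_copies g x| `^ p)%:E)).
  - by rewrite xs0 xsN.
  - by move=> i iN; exact/ltW/xsS.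
  - by rewrite xs0 xsN; apply/measurable_EFinP; exact: measurable_norm_powR.
  - by move=> x _; rewrite lee_fin powR_ge0.
rewrite -sumEFin [X in (_ <= X * _)%E]big_nat_cond ge0_sume_distrl; last first.
  move=> i /andP[/andP[i1 iN] _].
  by rewrite lee_fin mulr_ge0 ?powR_ge0// ltW// a_gt0// i1.
rewrite big_nat_cond; apply: lee_sum => i /andP[/andP[i1 iN'] _].
have iN : (1 <= i <= N)%N by rewrite i1.
have [mal _] := alphaL _ iN.
pose G x := (`|alpha i x * g x| `^ p)%:E.
have mG : measurable_fun I G.
  by apply/measurable_EFinP; apply: measurable_norm_powR; exact: measurable_funM.
rewrite (_ : (\int[mu]_(x in _) _)%E = (\int[mu]_(x in `[xs i.-1, xs i]) G (uinv xs i x))%E).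
  rewrite integral_copy//; last by move=> x _; rewrite lee_fin powR_ge0.
  rewrite EFinM -muleA lee_pmul2l// ?lte_fin ?a_gt0//.
  rewrite -ge0_integralZl_EFin//; last 2 first.
  - by apply/measurable_EFinP; exact: measurable_norm_powR.
  - by rewrite powR_ge0.
  apply: ae_ge0_le_integral => //.
  - by move=> x _; rewrite lee_fin powR_ge0.
  - by move=> x _; rewrite mule_ge0 ?lee_fin ?powR_ge0.
  - apply: measurable_funeM; apply/measurable_EFinP; exact: measurable_norm_powR.
  have := le_alpha _ iN; apply: filterS => x /[apply] ax.
  rewrite -EFinM lee_fin normrM powRM// ler_wpM2r ?powR_ge0//.
  by rewrite ge0_ler_powR ?nnegrE ?(ltW p0)//; exact: L0.
(* On the open subinterval only the i-th copy survives, and dropping the endpoints does not change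
   the integrals. *)
have ooI : `]xs i.-1, xs i[%classic `<=` (`[xs i.-1, xs i]%classic : set R).
  exact: subset_itv_oo_cc.
rewrite integral_itv_bndoo; last first.
  apply/measurable_EFinP; apply: (measurable_funS (E := I)) => //.
    exact: subset_trans ooI (itv_sub _ iN).
  exact: measurable_norm_powR.
rewrite [RHS]integral_itv_bndoo; last first.
  apply/measurable_EFinP.
  apply: (measurable_funS (E := `[xs i.-1, xs i]%classic)) => //.
  apply: (measurable_comp_uinv _ (fun y => `|alpha i y * g y| `^ p) iN).
  by apply: measurable_norm_powR; exact: measurable_funM.
apply: eq_integral => x; rewrite inE/= in_itv/= => xi.
by rewrite (scaled_copiesE i).
Qed.

End read_bajraktarevic.

(** * The integral MKZ operator *)

Section negative_binomial.
Context (R : realFieldType).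

(** By Pascal's rule, multiplication by 1 - x lowers [m] by one; truncation at [K] leaves a boundary
    term. *)
Lemma negbin_sum_succ (m K : nat) (x : R) :
  (1 - x) * \sum_(0 <= k < K) 'C(k + m.+1, k)%:R * x ^+ k =
  \sum_(0 <= k < K) 'C(k + m, k)%:R * x ^+ k - 'C(K + m, m.+1)%:R * x ^+ K.
Proof.
elim: K => [|K IH].
  by rewrite !big_geq// mulr0 bin_small// mul0r subr0.
rewrite !big_nat_recr//= mulrDr IH.
have -> : 'C(K + m.+1, K) = ('C(K + m, m.+1) + 'C(K + m, K))%N.
  rewrite -[in LHS]bin_sub ?leq_addr// addKn addnS binS; congr addn.
  by rewrite -bin_sub ?leq_addl// addnK.
have -> : 'C(K.+1 + m, m.+1) = ('C(K + m, m.+1) + 'C(K + m, K))%N.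
  rewrite addSn binS; congr addn.
  by rewrite -bin_sub ?leq_addl// addnK.
by rewrite natrD exprS; ring.
Qed.

(** Each factor 1 - x lowers [m] and drops a nonnegative boundary term, down to the geometric sum,
    where the value is 1 - x^K. *)
Lemma negbin_sum_le1 (m K : nat) (x : R) : 0 <= x <= 1 ->
  (1 - x) ^+ m.+1 * \sum_(0 <= k < K) 'C(k + m, k)%:R * x ^+ k <= 1.
Proof.
move=> /andP[x0 x1]; have y0 : 0 <= 1 - x by rewrite subr_ge0.
elim: m => [|m IH].
  have -> : (1 - x) ^+ 1 * \sum_(0 <= k < K) 'C(k + 0, k)%:R * x ^+ k = 1 - x ^+ K.
    rewrite expr1; elim: K => [|K IH]; first by rewrite big_geq// mulr0 expr0 subrr.
    by rewrite big_nat_recr//= mulrDr IH addn0 binn exprS; ring.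
  by rewrite lerBlDr lerDl exprn_ge0.
rewrite exprSr -mulrA negbin_sum_succ; apply: le_trans IH.
by rewrite ler_wpM2l ?exprn_ge0// lerBlDr lerDl mulr_ge0 ?exprn_ge0.
Qed.

End negative_binomial.

(** * The kernel and its intervals *)

Section mkz_kernel.
Context (R : realType).
Notation mu := (@lebesgue_measure R).
Notation I := (`[0%R, 1%R]%classic : set (measurableTypeR R)).
Variable n : nat.
Hypothesis n0 : (0 < n)%N.
Implicit Types (x s : R) (t f : R -> R).

Lemma mhat_ge0 k x : I x -> 0 <= mhat n k x.
Proof.
rewrite /= in_itv/= => /andP[x0 x1].
by rewrite /mhat !mulr_ge0 ?exprn_ge0 ?subr_ge0.
Qed.

(** The left endpoint of I_k. Its right endpoint is the next node, since [k.+1 + n] computes to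
    [(k + n).+1]. *)
Definition mkz_node k : R := k%:R / (k + n)%:R.

Let kn0 k : 0 < (k + n)%:R :> R.
Proof. by rewrite ltr0n addn_gt0 n0 orbT. Qed.

Lemma mkz_nodeS k : mkz_node k <= mkz_node k.+1.
Proof.
rewrite /mkz_node ler_pdivrMr// mulrAC ler_pdivlMr// -!natrM ler_nat.
by rewrite addSn mulnS mulSn leq_add2r leq_addr.
Qed.

Let node_le1 k : mkz_node k <= 1.
Proof. by rewrite /mkz_node ler_pdivrMr// mul1r ler_nat leq_addr. Qed.

Let node_ge0 k : 0 <= mkz_node k. Proof. by rewrite /mkz_node divr_ge0. Qed.

Lemma IkE k : Ik n k = `[mkz_node k, mkz_node k.+1]%classic :> set R.
Proof. by []. Qed.

Lemma Ik_sub k : Ik n k `<=` I.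
Proof.
rewrite IkE => s /=; rewrite !in_itv/= => /andP[s0 s1].
by rewrite (le_trans (node_ge0 k) s0) (le_trans s1 (node_le1 _)).
Qed.

Lemma measurable_Ik k : measurable (Ik n k : set (measurableTypeR R)).
Proof. exact: measurable_itv. Qed.

(** The nodes stay below 1 and tend to 1. Hence the series defining [Hn] has finitely many nonzero
    terms at each [s]. *)
Lemma Ik_eventually_notin s : \forall k \near \oo, ~ Ik n k s.
Proof.
have [s1|s1] := leP 1 s.
  apply: nearW => k; rewrite IkE /= in_itv/= => /andP[_ sn].
  have := le_trans s1 sn; rewrite leNgt /mkz_node ltr_pdivrMr// mul1r ltr_nat.
  by rewrite -[X in (X < _)%N]addn0 ltn_add2l n0.
(* k / (k + n) <= s means k (1 - s) <= s n, which fails once k > n / (1 - s), as s < 1. *)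
exists (Num.truncn (n%:R / (1 - s))).+1 => //= k kb.
rewrite IkE /= in_itv/= => /andP[+ _].
rewrite /mkz_node ler_pdivrMr// => ks.
have s1' : 0 < 1 - s by rewrite subr_gt0.
have : n%:R / (1 - s) < k%:R.
  apply: lt_le_trans (_ : (Num.truncn (n%:R / (1 - s))).+1%:R <= _); last by rewrite ler_nat.
  by rewrite truncnS_gt.
rewrite ltr_pdivrMr// natrD in ks *; apply/negP; rewrite -leNgt.
have : 0 <= n%:R :> R by [].
nra.
Qed.

(** The partial sums are eventually constant, so the real limit in [Hn] exists and agrees with the
    extended real series, for which monotone convergence is at hand. *)
Lemma Hn_series x s : I x ->
  (Hn n x s)%:E = (\sum_(0 <= k <oo) (mhat n k x * \1_(Ik n k) s)%:E)%E.
Proof.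
move=> Ix; rewrite /Hn -EFin_lim.
  congr (limn _); apply/funext => K /=; by rewrite sumEFin.
have [K _ KP] := Ik_eventually_notin s.
apply: (@is_cvg_near_cst _ _ (\sum_(0 <= k < K) mhat n k x * \1_(Ik n k) s)).
exists K => // m /= Km; rewrite (big_cat_nat _ Km)//=.
rewrite [X in _ + X]big_nat_cond [X in _ + X]big1 ?addr0// => k /andP[/andP[Kk _] _].
by rewrite indicE memNset ?mulr0//; exact: KP.
Qed.

Lemma Hn_ge0 x s : I x -> 0 <= Hn n x s.
Proof.
move=> Ix; rewrite -lee_fin Hn_series//; apply: nneseries_ge0 => k _ _.
by rewrite lee_fin mulr_ge0 ?mhat_ge0.
Qed.

Lemma measurable_Hn x : I x -> measurable_fun I (Hn n x).
Proof.
move=> Ix; apply/measurable_EFinP; rewrite (_ : EFin \o _ = (fun s =>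
    \sum_(0 <= k <oo | k \in xpredT) (mhat n k x * \1_(Ik n k) s)%:E)%E); last first.
  by apply/funext => s /=; rewrite Hn_series.
apply: ge0_emeasurable_sum => k.
  by move=> s _ _; rewrite lee_fin mulr_ge0 ?mhat_ge0.
move=> _; apply/measurable_EFinP; apply: measurable_funM => //.
by apply: measurable_funTS; apply: measurable_indic; exact: measurable_Ik.
Qed.

Lemma integral_Hn x t : I x -> measurable_fun I t -> (forall s, I s -> 0 <= t s) ->
  (\int[mu]_(s in I) (Hn n x s * t s)%:E =
   \sum_(0 <= k <oo) (mhat n k x)%:E * \int[mu]_(s in Ik n k) (t s)%:E)%E.
Proof.
move=> Ix mt t0.
have m1 k : measurable_fun I (fun s => (\1_(Ik n k) s * t s)%:E).
  apply/measurable_EFinP; apply: measurable_funM => //.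
  by apply: measurable_funTS; apply: measurable_indic; exact: measurable_Ik.
transitivity (\int[mu]_(s in I)
    \sum_(0 <= k <oo) ((mhat n k x)%:E * (\1_(Ik n k) s * t s)%:E))%E.
  apply: eq_integral => s; rewrite inE => Is.
  rewrite mulrC EFinM Hn_series// -nneseriesZl; last first.
    by move=> k _; rewrite lee_fin mulr_ge0 ?mhat_ge0.
  by apply: eq_eseriesr => k _; rewrite -!EFinM mulrCA (mulrC (t s)).
rewrite integral_nneseries//; last 2 first.
- by move=> k; exact: measurable_funeM.
- by move=> k s Is; rewrite lee_fin mulr_ge0 ?mhat_ge0// mulr_ge0 ?t0.
apply: eq_eseriesr => k _; rewrite ge0_integralZl_EFin ?mhat_ge0//; last first.
  by move=> s Is; rewrite lee_fin mulr_ge0 ?t0.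
congr (_ * _)%E; rewrite -[in RHS](setIidr (Ik_sub k)) integral_mkcondr.
apply: eq_integral => s _; rewrite patchE indicE.
by case: ifPn => _; rewrite ?mul1r ?mul0r.
Qed.

Lemma lebesgue_measure_Ik k : mu (Ik n k) = (mkz_node k.+1 - mkz_node k)%:E.
Proof.
rewrite IkE lebesgue_measure_itv/= lte_fin.
case: ifPn => [_|]; first by rewrite -EFinB.
rewrite -leNgt => h; rewrite (_ : mkz_node k = mkz_node k.+1) ?subrr//.
by apply/le_anti; rewrite mkz_nodeS h.
Qed.

(** The interval I_k has length n / ((k + n)(k + n + 1)), which turns the coefficient of [mhat] into
    a negative binomial one. *)
Lemma mhat_mass k x : mhat n k x * (mkz_node k.+1 - mkz_node k) =
  (1 - x) ^+ n * ('C(k + n.-1, k)%:R * x ^+ k).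
Proof.
have [m nm] : {m | n = m.+1} by exists n.-1; rewrite prednK.
(* Two applications of the absorption identity, with n = m + 1. *)
have bE : (m.+2 * m.+1 * 'C(k + m.+2, k) = (k + m.+1) * (k + m.+2) * 'C(k + m, k))%N.
  have h j : 'C(k + j, k) = 'C(k + j, j) by rewrite -bin_sub ?leq_addr// addKn.
  have e1 : (m.+2 * 'C(k + m.+2, m.+2) = (k + m.+2) * 'C(k + m.+1, m.+1))%N.
    by rewrite -mul_bin_diag addnS.
  have e2 : (m.+1 * 'C(k + m.+1, m.+1) = (k + m.+1) * 'C(k + m, m))%N.
    by rewrite -mul_bin_diag addnS.
  by rewrite !h (mulnC m.+2) -mulnA e1 mulnCA e2 mulnA (mulnC (k + m.+2)).
have {}bE : m.+2%:R * m.+1%:R * 'C(k + m.+2, k)%:R =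
    (k + m.+1)%:R * (k + m.+2)%:R * 'C(k + m, k)%:R :> R by rewrite -!natrM bE.
rewrite /mhat /mkz_node nm /=.
have k1 : (k + m.+1)%:R != 0 :> R by rewrite pnatr_eq0 addnS.
have k2 : (k + m.+2)%:R != 0 :> R by rewrite pnatr_eq0 addnS.
have -> : k.+1%:R / (k.+1 + m.+1)%:R - k%:R / (k + m.+1)%:R =
    m.+1%:R / ((k + m.+1)%:R * (k + m.+2)%:R) :> R.
  have ea : (k + m.+1)%:R = k%:R + m%:R + 1 :> R by rewrite -(addn1 m) !natrD addrA.
  have eb : (k + m.+2)%:R = k%:R + m%:R + 2 :> R.
    by rewrite -(addn2 m) !natrD addrA.
  rewrite addSnnS -(natr1 k) -(natr1 m) eb ea in k1 k2 *.
  by field; rewrite k1 k2.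
move: ((k + m.+1)%:R : R) ((k + m.+2)%:R : R) ('C(k + m.+2, k)%:R : R)
  ('C(k + m, k)%:R : R) bE k1 k2 => a b c d bE a0 b0.
transitivity (m.+2%:R * m.+1%:R * c * (x ^+ k * (1 - x) ^+ m.+1) / (a * b)).
  by field; rewrite a0 b0.
by rewrite bE; field; rewrite a0 b0.
Qed.

End mkz_kernel.

(** * A Jensen-type inequality for kernels of mass at most 1 *)

Section kernel_jensen.
Context d (T : measurableType d) (R : realType).
Variables (mu : {measure set T -> \bar R}) (D : set T) (p : R).
Hypotheses (mD : measurable D) (p1 : 1 <= p).

Let p0 : 0 < p. Proof. exact: lt_le_trans p1. Qed.
Let pn0 : p != 0. Proof. by rewrite gt_eqF. Qed.

(** If t > l, then t = t^(1-p) t^p <= l^(1-p) t^p, because 1 - p <= 0. *)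
Lemma le_add_powR (l t : R) : 0 < l -> 0 <= t ->
  t <= l + l `^ (1 - p) * t `^ p.
Proof.
move=> l0 t0; have [tl|lt] := leP t l.
  by rewrite (le_trans tl)// lerDl mulr_ge0 ?powR_ge0.
apply: (@le_trans _ _ (l `^ (1 - p) * t `^ p)); last by rewrite lerDr ltW.
have t0' : 0 < t by exact: lt_trans lt.
rewrite -{2}(subrK 1 p) (@powRD _ t); last by rewrite (gt_eqF t0') implybT.
rewrite powRr1// mulrA ler_peMl// -(opprB p 1) powRN mulrC.
rewrite ler_pdivlMr ?powR_gt0// mul1r.
by rewrite ge0_ler_powR ?nnegrE ?subr_ge0 ?(ltW l0) ?(ltW lt).
Qed.

(* A cheap substitute for Jensen's inequality: integrate
   [t <= l + l^(1-p) t^p] against [h] and optimize in [l]. *)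
Lemma ge0_integral_powR_le (h t : T -> R) :
  measurable_fun D h -> measurable_fun D t ->
  (forall x, D x -> 0 <= h x) -> (forall x, D x -> 0 <= t x) ->
  (\int[mu]_(x in D) (h x)%:E <= 1)%E ->
  ((\int[mu]_(x in D) (h x * t x)%:E) `^ p <=
   (2 `^ p)%:E * \int[mu]_(x in D) (h x * t x `^ p)%:E)%E.
Proof.
move=> mh mt h0 t0 h1.
set J := (\int[mu]_(x in D) (h x * t x `^ p)%:E)%E.
set K := (\int[mu]_(x in D) (h x * t x)%:E)%E.
have J0 : (0 <= J)%E by apply: integral_ge0 => x Dx; rewrite lee_fin mulr_ge0 ?h0 ?powR_ge0.
have K0 : (0 <= K)%E by apply: integral_ge0 => x Dx; rewrite lee_fin mulr_ge0 ?h0 ?t0.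
have mtp : measurable_fun D (fun x => t x `^ p).
  by apply: (measurableT_comp (measurable_powR p)).
have key l : 0 < l -> (K <= l%:E + (l `^ (1 - p))%:E * J)%E.
  move=> l0.
  have ll0 : 0 <= l by exact: ltW.
  have -> : ((l `^ (1 - p))%:E * J =
      \int[mu]_(x in D) ((l `^ (1 - p))%:E * (h x * t x `^ p)%:E))%E.
    rewrite ge0_integralZl_EFin ?powR_ge0//.
      by move=> x Dx; rewrite lee_fin mulr_ge0 ?h0 ?powR_ge0.
    by apply/measurable_EFinP; exact: measurable_funM.
  apply: (@le_trans _ _ (\int[mu]_(x in D) (l%:E * (h x)%:E) +
     \int[mu]_(x in D) ((l `^ (1 - p))%:E * (h x * t x `^ p)%:E))%E); last first.
    rewrite leeD2r// ge0_integralZl_EFin//; last by apply/measurable_EFinP.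
    by rewrite -[leRHS]mule1 lee_wpmul2l.
  rewrite -ge0_integralD//; last 4 first.
  - by move=> x Dx; rewrite mule_ge0 ?lee_fin ?h0.
  - by apply: measurable_funeM; apply/measurable_EFinP.
  - by move=> x Dx; rewrite mule_ge0 ?lee_fin ?powR_ge0// mulr_ge0 ?h0 ?powR_ge0.
  - by apply: measurable_funeM; apply/measurable_EFinP; exact: measurable_funM.
  apply: ge0_le_integral => //.
  - by move=> x Dx; rewrite lee_fin mulr_ge0 ?h0 ?t0.
  - by apply/measurable_EFinP; exact: measurable_funM.
  - apply: emeasurable_funD; apply: measurable_funeM; apply/measurable_EFinP => //.
    exact: measurable_funM.
  - move=> x Dx; rewrite -!EFinM -EFinD lee_fin (mulrC l) mulrCA -mulrDr.
    by rewrite ler_wpM2l ?h0// le_add_powR// t0.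
have [->|Jfin] := eqVneq J +oo%E.
  by rewrite gt0_muley ?leey// lte_fin powR_gt0.
have {Jfin}Jfin : J \is a fin_num by rewrite ge0_fin_numE// ltey.
(* When J = 0 there is no positive optimal [l]; letting [l] tend to 0 in [key] gives K = 0. *)
have [Jz|Jn0] := eqVneq J 0%E.
  have -> : K = 0%E.
    apply/eqP; rewrite eq_le K0 andbT; apply/lee_addgt0Pr => e e0.
    by have := key _ e0; rewrite Jz mule0 adde0 add0e.
  by rewrite Jz poweR0r ?mule0.
(* This choice balances the two terms: l^(1-p) J = l, hence K <= 2l and K^p <= 2^p J. *)
pose l := fine J `^ p^-1.
have Jpos : 0 < fine J by rewrite fine_gt0// lt0e Jn0 J0 -ge0_fin_numE.
have l0 : 0 < l by rewrite powR_gt0.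
have lp : l `^ p = fine J by rewrite -powRrM mulVf// powRr1// ltW.
have K2l : (K <= (2 * l)%:E)%E.
  apply: le_trans (key _ l0) _; rewrite -(fineK Jfin) -lp -EFinM -EFinD lee_fin.
  rewrite -powRD; last by rewrite subrK oner_eq0.
  by rewrite subrK powRr1 ?(ltW l0)// mulr_natl mulr2n.
rewrite -(fineK Jfin) -EFinM -lp -powRM ?(ltW l0)// -poweR_EFin.
apply: gt0_ler_poweR => //; rewrite ?in_itv/= ?K0 ?leey ?(ltW p0)//.
by rewrite lee_fin mulr_ge0 ?(ltW l0).
Qed.

End kernel_jensen.

(** * Marginals of the kernel, linearity and measurability *)

Section mkz_operator.
Context (R : realType).
Notation mu := (@lebesgue_measure R).
Notation I := (`[0%R, 1%R]%classic : set (measurableTypeR R)).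
Variable n : nat.
Hypothesis n0 : (0 < n)%N.
Implicit Types (x s : R) (t f g : R -> R).

Lemma negbin_series_le1 K x : I x ->
  \sum_(0 <= k < K) (1 - x) ^+ n * ('C(k + n.-1, k)%:R * x ^+ k) <= 1.
Proof.
rewrite /= in_itv/= => x01; rewrite -mulr_sumr.
by rewrite -[X in (1 - x) ^+ X](prednK n0); exact: negbin_sum_le1.
Qed.

Lemma integral_Hn_le1 x : I x -> (\int[mu]_(s in I) (Hn n x s)%:E <= 1)%E.
Proof.
move=> Ix; under eq_integral do rewrite -[Hn n x _]mulr1.
rewrite (@integral_Hn _ _ n0 _ (cst 1))//.
apply: lime_le.
  apply: is_cvg_nneseries => k _ _.
  by rewrite mule_ge0 ?lee_fin ?mhat_ge0// integral_ge0.
apply: nearW => K; rewrite (eq_bigr (fun k =>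
    ((1 - x) ^+ n * ('C(k + n.-1, k)%:R * x ^+ k))%:E)).
  by rewrite sumEFin lee_fin negbin_series_le1.
move=> k _; have -> : (\int[mu]_(s in Ik n k) (cst 1 s)%:E = mu (Ik n k))%E.
  exact: etrans (integral_cst mu (measurable_Ik R n k) 1%E) (mul1e _).
by rewrite lebesgue_measure_Ik// -EFinM mhat_mass.
Qed.

Lemma measurable_mhat k : measurable_fun I (mhat n k).
Proof.
apply: (eq_measurable_fun (fun x => n.+1%:R * 'C(k + n.+1, k)%:R * XMonemX k n x)).
  by move=> x _; rewrite -[XMonemX _ _ x]/(x ^+ k * (1 - x) ^+ n) mulrA.
by apply: measurable_funM => //; exact: measurable_XMonemX.
Qed.

(** (n + 1) C(k + n + 1, k) = (k + n + 1)! / (k! n!) is the inverse of the beta integral with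
    parameters k + 1 and n + 1. *)
Lemma integral_mhat k : (\int[mu]_(x in I) (mhat n k x)%:E = 1)%E.
Proof.
have c0 : 0 <= n.+1%:R * 'C(k + n.+1, k)%:R :> R by [].
transitivity (\int[mu]_(x in I) ((n.+1%:R * 'C(k + n.+1, k)%:R)%:E *
    (XMonemX k n x)%:E))%E.
  by apply: eq_integral => x _; rewrite -EFinM -[XMonemX _ _ x]/(x ^+ k * (1 - x) ^+ n) mulrA.
rewrite ge0_integralZl_EFin//; last 2 first.
- by move=> x Ix; rewrite lee_fin XMonemX_ge0.
- by apply/measurable_EFinP; exact: measurable_XMonemX.
have -> : (\int[mu]_(x in I) (XMonemX k n x)%:E = (beta_fun k.+1 n.+1)%:E :> \bar R)%E.
  rewrite EFin_beta_fun integral_mkcond; apply: eq_integral => x _.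
  by rewrite !patchE; case: ifPn.
have := bin_fact (leq_addr n.+1 k); rewrite addKn addnS factS => bf.
rewrite beta_fun_fact -EFinM -bf.
rewrite !natrM; congr EFin.
have h1 : n.+1%:R != 0 :> R by rewrite pnatr_eq0.
have h2 : 'C((k + n).+1, k)%:R != 0 :> R.
  by rewrite pnatr_eq0 -lt0n bin_gt0 -addnS leq_addr.
have h3 m : m`!%:R != 0 :> R by rewrite pnatr_eq0 -lt0n fact_gt0.
move: (n.+1%:R : R) h1 ('C((k + n).+1, k)%:R : R) h2 (k`!%:R : R) (h3 k)
  (n`!%:R : R) (h3 n) => a a0 b b0 c c0' e e0.
by field; rewrite a0 b0 c0' e0.
Qed.

(** The first [K] intervals form a partition of [0, [mkz_node R n K]], which is contained in [I]. *)
Lemma sum_integral_Ik t : measurable_fun I t -> (forall s, I s -> 0 <= t s) ->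
  (\sum_(0 <= k <oo) \int[mu]_(s in Ik n k) (t s)%:E <=
   \int[mu]_(s in I) (t s)%:E)%E.
Proof.
move=> mt t0; apply: lime_le.
  apply: is_cvg_nneseries => k _ _; apply: integral_ge0 => s /(Ik_sub _ _ n0).
  by rewrite lee_fin; exact: t0.
apply: nearW => K.
have sub : `[mkz_node R n 0, mkz_node R n K]%classic `<=` I.
  move=> s /=; rewrite !in_itv/= /mkz_node mul0r => /andP[-> sK].
  apply: le_trans sK _; rewrite ler_pdivrMr ?mul1r ?ler_nat ?leq_addr//.
  by rewrite ltr0n addn_gt0 n0 orbT.
have mt' : measurable_fun (`[mkz_node R n 0, mkz_node R n K]%classic : set R) (EFin \o t).
  by apply/measurable_EFinP; apply: measurable_funS mt.
rewrite -(ge0_integral_partition R (mkz_node R n) K (EFin \o t))//.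
- by apply: ge0_subset_integral => //; exact/measurable_EFinP.
- by move=> i _; exact: (mkz_nodeS _ _ n0).
- by move=> s /sub Is; rewrite /= lee_fin t0.
Qed.

(** For x < 1 the negative binomial bound with m = n + 1 gives at most (n + 1) / (1 - x)^2. At x = 1
    every term vanishes, since n > 0. *)
Lemma sum_mhat_lty x : I x -> (\sum_(0 <= k <oo) (mhat n k x)%:E < +oo)%E.
Proof.
move=> Ix; have := Ix; rewrite /= in_itv/= => /andP[x0].
rewrite le_eqVlt => /predU1P[->|x1].
  rewrite eseries0// => k _ _.
  by rewrite /mhat subrr expr0n gtn_eqF// mulr0.
have y0 : 0 < 1 - x by rewrite subr_gt0.
apply: (@le_lt_trans _ _ (n.+1%:R / (1 - x) ^+ 2)%:E); last exact: ltry.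
apply: lime_le.
  by apply: is_cvg_nneseries => k _ _; rewrite lee_fin mhat_ge0.
apply: nearW => K; rewrite sumEFin lee_fin.
have -> : \sum_(0 <= k < K) mhat n k x = n.+1%:R * ((1 - x) ^+ n *
    \sum_(0 <= k < K) 'C(k + n.+1, k)%:R * x ^+ k).
  by rewrite mulrA mulr_sumr; apply: eq_bigr => k _; rewrite /mhat; ring.
rewrite ler_wpM2l// -[leRHS]div1r ler_pdivlMr ?exprn_gt0// mulrAC -exprD addn2.
by apply: negbin_sum_le1; rewrite x0 ltW.
Qed.

(** Each integral of |f| over I_k is at most the one over [I], so the total is bounded by the sum of
    the [mhat n k x] times the L^1 norm of f. *)
Lemma Hn_integrable x f : I x -> mu.-integrable I (EFin \o f) ->
  mu.-integrable I (fun s => (Hn n x s * f s)%:E).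
Proof.
move=> Ix /integrableP[/measurable_EFinP mf fy]; apply/integrableP; split.
  by apply/measurable_EFinP; apply: measurable_funM => //; exact: measurable_Hn.
rewrite [X in (X < _)%E](_ : _ = \int[mu]_(s in I) (Hn n x s * `|f s|)%:E)%E; last first.
  by apply: eq_integral => s _; rewrite /= normrM ger0_norm// Hn_ge0.
have mnf : measurable_fun I (fun s => `|f s|) by exact: measurableT_comp.
rewrite integral_Hn//; apply: (@le_lt_trans _ _
   (\sum_(0 <= k <oo) ((mhat n k x)%:E * \int[mu]_(s in I) `|f s|%:E))%E).
  apply: lee_nneseries => k _.
    by move=> _; rewrite mule_ge0 ?lee_fin ?mhat_ge0// integral_ge0.
  rewrite lee_wpmul2l ?lee_fin ?mhat_ge0// ge0_subset_integral//.
  - exact: measurable_Ik.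
  - exact/measurable_EFinP.
  - exact: Ik_sub.
have cfin : (\int[mu]_(s in I) `|f s|%:E)%E \is a fin_num.
  by rewrite ge0_fin_numE// integral_ge0.
under eq_eseriesr do rewrite -(fineK cfin) muleC.
rewrite nneseriesZl; last by move=> k _; rewrite lee_fin mhat_ge0.
apply: lte_mul_pinfty; rewrite ?lee_fin ?fine_ge0 ?integral_ge0//.
exact: sum_mhat_lty.
Qed.

Lemma Mhat_linear (c1 c2 : R) f g x : I x ->
  mu.-integrable I (EFin \o f) -> mu.-integrable I (EFin \o g) ->
  Mhat n (fun s => c1 * f s + c2 * g s) x = c1 * Mhat n f x + c2 * Mhat n g x.
Proof.
move=> Ix fi gi; have Hf := Hn_integrable _ _ Ix fi; have Hg := Hn_integrable _ _ Ix gi.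
rewrite /Mhat -!RintegralZl// -RintegralD//; last 2 first.
- exact: (integrableZl (measurable_itv01 R) c1 Hf).
- exact: (integrableZl (measurable_itv01 R) c2 Hg).
by apply: eq_Rintegral => s _; ring.
Qed.

Lemma measurable_Mhat f : mu.-integrable I (EFin \o f) ->
  measurable_fun I (Mhat n f).
Proof.
move=> fi; have /integrableP[/measurable_EFinP mf fy] := fi.
(* For a nonnegative function [Mhat] is a series of measurable functions on [I]; the general case
   uses f = (|f| + f) - |f|. *)
have ge0_case g : measurable_fun I g -> (forall s, 0 <= g s) ->
    measurable_fun I (Mhat n g).
  move=> mg g0; apply: (eq_measurable_fun (fun x => fine
      (\sum_(0 <= k <oo | k \in xpredT)
         (mhat n k x)%:E * \int[mu]_(s in Ik n k) (g s)%:E)%E)).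
    by move=> x; rewrite inE => Ix; rewrite /Mhat /Rintegral integral_Hn.
  apply: (measurableT_comp (fine_measurable _)) => //.
  apply: ge0_emeasurable_sum => k.
    move=> x Ix _; rewrite mule_ge0 ?lee_fin ?mhat_ge0// integral_ge0// => s _.
    by rewrite lee_fin.
  move=> _; apply: emeasurable_funM => //; apply/measurable_EFinP.
  exact: measurable_mhat.
have fp : mu.-integrable I (EFin \o (fun s => `|f s|)).
  exact: integrable_abse fi.
apply: (eq_measurable_fun (fun x => - 1 * Mhat n (fun s => `|f s|) x +
    1 * Mhat n (fun s => `|f s| + f s) x)).
  move=> x; rewrite inE => Ix; rewrite -Mhat_linear//; last first.
    by apply: (integrableD (measurable_itv01 R) fp fi).
  by rewrite /Mhat; apply: eq_Rintegral => s _; congr (_ * _); ring.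
apply: measurable_funD; apply: measurable_funM => //; apply: ge0_case => //.
- exact: measurableT_comp.
- by apply: measurable_funD => //; exact: measurableT_comp.
- by move=> s; rewrite -lerBlDr sub0r -normrN ler_norm.
Qed.

End mkz_operator.

(** * Boundedness on L^p *)

Section mkz_bound.
Context (R : realType).
Notation mu := (@lebesgue_measure R).
Notation I := (`[0%R, 1%R]%classic : set (measurableTypeR R)).
Variables (n : nat) (p : R).
Hypotheses (n0 : (0 < n)%N) (p1 : 1 <= p).

Let p0 : 0 < p. Proof. exact: lt_le_trans p1. Qed.

(** [I] has finite measure and |f| <= 1 + |f|^p. *)
Lemma inL_integrable f : inL p%:E f -> mu.-integrable I (EFin \o f).
Proof.
move=> /(inLP _ _ p1)[mf fp]; apply/integrableP; split; first exact/measurable_EFinP.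
apply: (@le_lt_trans _ _ (\int[mu]_(x in I) (1 + (`|f x| `^ p)%:E))%E).
  apply: ge0_le_integral => //.
  - by apply/measurable_EFinP; exact: measurableT_comp.
  - apply: emeasurable_funD => //; apply/measurable_EFinP.
    exact: measurable_norm_powR.
  move=> x _; rewrite /= -EFinD lee_fin.
  have [f1|f1] := leP `|f x| 1; first by rewrite (le_trans f1)// lerDl powR_ge0.
  apply: (@le_trans _ _ (`|f x| `^ p)); last by rewrite lerDr.
  by rewrite -[leLHS]powRr1// ler_powR// ltW.
rewrite ge0_integralD//; last by apply/measurable_EFinP; exact: measurable_norm_powR.
rewrite lte_add_pinfty// integral_cst; last exact: measurable_itv01.
by rewrite mul1e /= lebesgue_measure_itv/= lte_fin ltr01 oppr0 adde0 ltry.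
Qed.

(** The Jensen-type inequality in [s] gives |M f|^p <= 2^p S on [I]. Integrating [S] in [x] term by
    term replaces each [mhat] by 1 and leaves the integrals of |f|^p over the I_k. The factor 2 is
    the loss in the Jensen-type step. *)
Lemma normL_Mhat f : inL p%:E f ->
  (normL p%:E (Mhat n f) <= 2%:E * normL p%:E f)%E.
Proof.
move=> fL; have fi := inL_integrable _ fL.
have /(inLP _ _ p1)[mf fp] := fL.
apply: le_normL => //.
have mnf : measurable_fun I (fun s => `|f s|) by exact: measurableT_comp.
have mfp : measurable_fun I (fun s => `|f s| `^ p) by exact: measurable_norm_powR.
pose c k := (\int[mu]_(s in Ik n k) (`|f s| `^ p)%:E)%E.
have c0 k : (0 <= c k)%E by apply: integral_ge0 => s _; rewrite lee_fin powR_ge0.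
pose S x := (\sum_(0 <= k <oo) (mhat n k x)%:E * c k)%E.
have mmhat k : measurable_fun I (EFin \o mhat n k).
  by apply/measurable_EFinP; exact: measurable_mhat.
have mterm k : measurable_fun I (fun x => (mhat n k x)%:E * c k)%E.
  by apply: emeasurable_funM => //; exact: mmhat.
have term0 k x : I x -> (0 <= (mhat n k x)%:E * c k)%E.
  by move=> Ix; rewrite mule_ge0 ?lee_fin ?mhat_ge0.
have S0 x : I x -> (0 <= S x)%E.
  by move=> Ix; apply: nneseries_ge0 => k _ _; exact: term0.
have mS : measurable_fun I S.
  by apply: ge0_emeasurable_sum => k // x Ix _; exact: term0.
apply: (@le_trans _ _ (\int[mu]_(x in I) ((2 `^ p)%:E * S x))%E).
  apply: ge0_le_integral => //.
  - by apply/measurable_EFinP; apply: measurable_norm_powR; exact: measurable_Mhat.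
  - exact: measurable_funeM.
  move=> x Ix; rewrite /S /c -(integral_Hn _ _ n0 _ (fun s => `|f s| `^ p))//.
  have Hx0 s : I s -> 0 <= Hn n x s by move=> _; exact: Hn_ge0.
  apply: le_trans _ (ge0_integral_powR_le _ _ _ _ _ _ (measurable_itv01 R) p1
    (Hn n x) (fun s => `|f s|) _ mnf Hx0 _ _) => //; last 2 first.
  - exact: measurable_Hn.
  - exact: integral_Hn_le1.
  have Mle : (`|Mhat n f x|%:E <= \int[mu]_(s in I) (Hn n x s * `|f s|)%:E)%E.
    have Hi := Hn_integrable _ _ n0 _ _ Ix fi.
    rewrite /Mhat EFin_normr_Rintegral//.
    apply: le_trans (le_abse_integral _ _ _) _ => //.
    - by have /integrableP[] := Hi.
    - apply: ge0_le_integral => //.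
      + by apply: measurableT_comp => //; have /integrableP[] := Hi.
      + by apply/measurable_EFinP; apply: measurable_funM => //; exact: measurable_Hn.
      + by move=> s _; rewrite /= normrM ger0_norm// Hn_ge0.
  rewrite -poweR_EFin; apply: gt0_ler_poweR => //; rewrite ?in_itv/= ?leey ?andbT ?(ltW p0)//.
  by rewrite integral_ge0// => s Is; rewrite lee_fin mulr_ge0 ?Hx0.
rewrite ge0_integralZl_EFin ?powR_ge0// lee_pmul2l ?lte_fin ?powR_gt0//.
rewrite integral_nneseries//.
apply: le_trans (sum_integral_Ik _ _ n0 _ mfp (fun s _ => powR_ge0 _ _)).
apply: lee_nneseries => k _.
  by move=> _; apply: integral_ge0 => x Ix; exact: term0.
rewrite ge0_integralZr//; [|exact: mmhat|by move=> x Ix; rewrite lee_fin mhat_ge0].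
by rewrite integral_mhat mul1e.
Qed.

Lemma inL_Mhat f : inL p%:E f -> inL p%:E (Mhat n f).
Proof.
move=> fL; split; first exact: measurable_Mhat (inL_integrable _ fL).
apply: le_lt_trans (normL_Mhat _ fL) _.
by rewrite lte_mul_pinfty// ?lee_fin//; case: fL.
Qed.

End mkz_bound.

(** * The fractal function *)

Section alpha_fractal.
Context (R : realType).
Notation I := (`[0%R, 1%R]%classic : set (measurableTypeR R)).
Variables (p : R) (n N : nat) (xs : nat -> R) (alpha : nat -> R -> R).
Hypotheses (p1 : 1 <= p) (n0 : (0 < n)%N) (xs0 : xs 0%N = 0) (xsN : xs N = 1).
Hypothesis xsS : forall i, (i < N)%N -> xs i < xs i.+1.
Hypothesis alphaL : forall i, (1 <= i <= N)%N -> inL +oo%E (alpha i).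
Hypothesis Lambda_lt1 : Lambda p N xs alpha < 1.
Implicit Types f g h : R -> R.

Local Notation A := (scaled_copies R N xs alpha).
Local Notation L := (Lambda p N xs alpha).
Local Notation T := (Top n N xs alpha).

Lemma TopE f g : T f g = (f \+ A (g \- Mhat n f))%R.
Proof. by []. Qed.

(** The terms in [f], including [Mhat n f], cancel, so the Lipschitz constant is that of the copies
    alone. *)
Lemma TopB f g h : (T f g \- T f h)%R = A (g \- h)%R.
Proof.
apply/funext => x; rewrite !TopE /=.
rewrite (_ : (g \- h)%R = fun y => 1 * (g \- Mhat n f) y + - 1 * (h \- Mhat n f) y).
  by rewrite scaled_copies_linear; ring.
by apply/funext => y /=; ring.
Qed.

Let leA g : measurable_fun I g -> (normL p%:E (A g) <= L%:E * normL p%:E g)%E.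
Proof. exact: normL_scaled_copies. Qed.

Let inLA g : inL p%:E g -> inL p%:E (A g).
Proof.
move=> [mg gy]; split; first exact: (measurable_scaled_copies R N xs alpha).
apply: le_lt_trans (leA _ mg) _.
by rewrite lte_mul_pinfty// lee_fin Lambda_ge0.
Qed.

Lemma inL_Top f g : inL p%:E f -> inL p%:E g -> inL p%:E (T f g).
Proof.
move=> fL gL; rewrite TopE; apply: inLD => //; apply: inLA; apply: inLB => //.
exact: inL_Mhat.
Qed.

Lemma Top_contraction f g h : inL p%:E g -> inL p%:E h ->
  (normL p%:E (T f g \- T f h)%R <= L%:E * normL p%:E (g \- h)%R)%E.
Proof.
move=> [mg _] [mh _]; rewrite TopB; apply: leA.
exact: measurable_funB.
Qed.

Lemma Top_fixpoint f : inL p%:E f ->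
  exists fa, inL p%:E fa /\ fa = T f fa %[ae (muI R)].
Proof.
(* The contraction principle works with functions measurable everywhere, so the image is cut off
   outside [I]. *)
move=> fL; pose S g := T f g \_ I.
have L01 : 0 <= L < 1 by rewrite Lambda_ge0.
have inLT g : measurable_fun setT g -> finite_norm (muI R) p%:E g -> inL p%:E g.
  by move=> mg gy; split => //; exact: measurable_funTS.
have [||fa [mfa fay fE]] := Lnorm_contraction_fixpoint _ _ _ (muI R) p p1 S L L01.
- move=> g mg gy; have [mT Ty] := inL_Top _ _ fL (inLT _ mg gy).
  split; first exact: measurable_patchI.
  by rewrite /finite_norm -/(normL _ _) normL_patch.
- move=> g h mg gy mh hy.
  have := Top_contraction f _ _ (inLT _ mg gy) (inLT _ mh hy).
  rewrite -normL_patch// (_ : (T f g \- T f h) \_ I = S g \- S h)//.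
  by apply/funext => x /=; rewrite /S !patchE; case: ifPn => //; rewrite subrr.
exists fa; split; first exact: inLT.
have := ae_muI R; apply: filterS2 fE => x + Ix _ => /(_ Logic.I).
by rewrite /S patchE mem_set.
Qed.

(** The norm z of g - h is finite and satisfies z <= L z with L < 1, hence z = 0. *)
Lemma Top_fixpoint_unique f g h : inL p%:E f -> inL p%:E g -> inL p%:E h ->
  g = T f g %[ae (muI R)] -> h = T f h %[ae (muI R)] -> g = h %[ae (muI R)].
Proof.
move=> fL gL hL gT hT.
have [[mg _] [mh _]] := (gL, hL).
have [mTg _] := inL_Top _ _ fL gL; have [mTh _] := inL_Top _ _ fL hL.
have E : normL p%:E (g \- h)%R = normL p%:E (T f g \- T f h)%R.
  apply: ae_eq_normL => //; [exact: measurable_funB..|].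
  apply: (@filterS2 _ (almost_everywhere (muI R)) _ _ _ _ _ gT hT) => x gx hx _.
  by rewrite /= -(gx Logic.I) -(hx Logic.I).
have := Top_contraction f _ _ gL hL; rewrite -E.
have /fineK <- := inL_finite _ _ _ (inLB _ _ p1 _ _ gL hL).
rewrite -EFinM lee_fin => le.
have z0 : 0 <= fine (normL p%:E (g \- h)%R) by rewrite fine_ge0// normL_ge0.
have z : fine (normL p%:E (g \- h)%R) = 0.
  apply/le_anti; rewrite z0 andbT.
  by have := Lambda_lt1; nra.
have /(normL_eq0 _ _ p1) : normL p%:E (g \- h)%R = 0%E.
  by rewrite -(fineK (inL_finite _ _ _ (inLB _ _ p1 _ _ gL hL))) z.
move=> /(_ (measurable_funB mg mh)); move=> gh0.
apply: (@filterS _ (almost_everywhere (muI R)) _ _ _ _ gh0) => x /(_ Logic.I) /= + _.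
by move=> /eqP; rewrite subr_eq0 => /eqP.
Qed.

(** [Top] is jointly linear in (f, g), at every point, so a combination of fixed points is a fixed
    point for the combined data. *)
Lemma Top_linear (c1 c2 : R) f1 f2 g1 g2 x : inL p%:E f1 -> inL p%:E f2 ->
  T (c1 *: f1 + c2 *: f2) (c1 *: g1 + c2 *: g2) x =
  c1 * T f1 g1 x + c2 * T f2 g2 x.
Proof.
move=> f1L f2L.
have fi1 := inL_integrable _ _ p1 _ f1L; have fi2 := inL_integrable _ _ p1 _ f2L.
rewrite !TopE /= (eq_scaled_copies R N xs alpha xsS _ (fun y =>
    c1 * (g1 \- Mhat n f1) y + c2 * (g2 \- Mhat n f2) y)).
  rewrite scaled_copies_linear -[(c1 *: f1 + c2 *: f2) x]/(c1 * f1 x + c2 * f2 x).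
  by ring.
move=> y; rewrite inE => Iy /=.
rewrite -[(c1 *: g1 + c2 *: g2) y]/(c1 * g1 y + c2 * g2 y).
rewrite -[Mhat n (c1 *: f1 + c2 *: f2)]/(Mhat n (fun s => c1 * f1 s + c2 * f2 s)).
by rewrite Mhat_linear//; ring.
Qed.

(** The fixed point equation gives |fa| <= |f| + L (|fa| + 2 |f|) in norm, where 2 bounds the MKZ
    operator. Finiteness of |fa| allows solving for it, which yields the constant. *)
Lemma Top_fixpoint_bounded f fa : inL p%:E f -> inL p%:E fa ->
  fa = T f fa %[ae (muI R)] ->
  (normL p%:E fa <= ((1 + 2 * L) / (1 - L))%:E * normL p%:E f)%E.
Proof.
move=> fL faL faT; have [[mf _] [mfa _]] := (fL, faL).
have ML := inL_Mhat _ _ _ n0 p1 _ fL; have [mM _] := ML.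
have [mT _] := inL_Top _ _ fL faL.
have mfM : measurable_fun I (fa \- Mhat n f)%R by exact: measurable_funB.
have mA : measurable_fun I (A (fa \- Mhat n f)%R).
  exact: (measurable_scaled_copies R N xs alpha).
have : (normL p%:E fa <= normL p%:E f +
    L%:E * (normL p%:E fa + 2%:E * normL p%:E f))%E.
  rewrite {1}(ae_eq_normL _ _ _ _ mfa mT faT) TopE.
  apply: le_trans (normLD _ _ p1 _ _ mf mA) _.
  rewrite leeD2l//; apply: le_trans (leA _ mfM) _.
  rewrite lee_wpmul2l ?lee_fin ?Lambda_ge0//.
  have mNM : measurable_fun I (\- Mhat n f)%R by exact: measurableT_comp.
  apply: le_trans (normLD _ _ p1 _ _ mfa mNM) _.
  by rewrite leeD2l// normLN// normL_Mhat.
have /fineK <- := inL_finite _ _ _ fL; have /fineK <- := inL_finite _ _ _ faL.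
rewrite -!(EFinM, EFinD) !lee_fin => le.
rewrite mulrAC ler_pdivlMr ?subr_gt0//; lra.
Qed.

End alpha_fractal.

Theorem theorem6p2 (R : realType) (p : R) (n N : nat) (xs : nat -> R)
    (alpha : nat -> R -> R) :
  1 <= p -> (0 < n)%N ->
  xs 0%N = 0 -> xs N = 1 -> (forall i, (i < N)%N -> xs i < xs i.+1) ->
  (forall i, (1 <= i <= N)%N -> inL +oo%E (alpha i)) ->
  Lambda p N xs alpha < 1 ->
  (* T : L^p(I) -> L^p(I) is a contraction with Lipschitz constant Lambda *)
  (forall f, inL p%:E f ->
     (forall g, inL p%:E g -> inL p%:E (Top n N xs alpha f g)) /\
     (forall g h, inL p%:E g -> inL p%:E h ->
        (normL p%:E (Top n N xs alpha f g \- Top n N xs alpha f h)%R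
         <= (Lambda p N xs alpha)%:E * normL p%:E (g \- h)%R)%E)) /\
  (* unique fixed point f^alpha_n in L^p(I) (up to a.e. equality on I) *)
  (forall f, inL p%:E f ->
     exists2 fa, inL p%:E fa /\ fa = Top n N xs alpha f fa %[ae (@muI R)] &
       forall g, inL p%:E g -> g = Top n N xs alpha f g %[ae (@muI R)] ->
         g = fa %[ae (@muI R)]) /\
  (* f |-> f^alpha_n is linear ... *)
  (forall (c1 c2 : R) f1 f2 fa1 fa2,
     inL p%:E f1 -> inL p%:E f2 ->
     inL p%:E fa1 -> fa1 = Top n N xs alpha f1 fa1 %[ae (@muI R)] ->
     inL p%:E fa2 -> fa2 = Top n N xs alpha f2 fa2 %[ae (@muI R)] ->
     (c1 *: fa1 + c2 *: fa2) =
       Top n N xs alpha (c1 *: f1 + c2 *: f2) (c1 *: fa1 + c2 *: fa2) %[ae (@muI R)]) /\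
  (* ... and bounded *)
  (exists C : R, forall f fa, inL p%:E f ->
     inL p%:E fa -> fa = Top n N xs alpha f fa %[ae (@muI R)] ->
     (normL p%:E fa <= C%:E * normL p%:E f)%E).
Proof.
move=> p1 n0 xs0 xsN xsS alphaL Lambda_lt1; split; [|split; [|split]].
- move=> f fL; split; first by move=> g; exact: inL_Top.
  by move=> g h; exact: Top_contraction.
- move=> f fL.
  have [fa [faL faT]] := Top_fixpoint _ _ _ _ _ _ p1 n0 xs0 xsN xsS alphaL Lambda_lt1 _ fL.
  exists fa => // g gL gT.
  exact: Top_fixpoint_unique p1 n0 xs0 xsN xsS alphaL Lambda_lt1 _ _ _ fL gL faL gT faT.
(* Together with uniqueness, the fixed point equation for the combination expresses linearity of the
   map from f to its fixed point. *)
- move=> c1 c2 f1 f2 fa1 fa2 f1L f2L _ fa1T _ fa2T.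
  apply: (@filterS2 _ (almost_everywhere (muI R)) _ _ _ _ _ fa1T fa2T) => x fx1 fx2 _.
  rewrite (Top_linear _ _ _ _ _ _ p1 n0 xsS) -?fx1 -?fx2//.
- exists ((1 + 2 * Lambda p N xs alpha) / (1 - Lambda p N xs alpha)).
  by move=> f fa; exact: Top_fixpoint_bounded.
Qed.
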